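(* Let $X^{\mathrm{in}}\subseteq\mathbb{R}^d$ be nonempty, let $T:\mathbb{R}^d\to\mathbb{R}^d$ be a nonzero map, and let $\varphi:\mathbb{R}^d\to\mathbb{R}$ satisfy $\varphi(0)=0$. For $k\in\mathbb{N}$ let $\nu_k:=\sup\{\varphi(T^k(x)) : x\in X^{\mathrm{in}}\}$, and assume that $\nu_k$ is finite for every $k\in\mathbb{N}$; write $\nu=(\nu_k)_{k\in\mathbb{N}}$. Suppose that $\varphi$ is continuous and that $X^{\mathrm{in}}$ is bounded and not reduced to $\{0\}$. Assume that there exists $\gamma\in\mathcal{KL}$ such that for all $x\in X^{\mathrm{in}}$ and all $k\in\mathbb{N}$, $$\|T^k(x)\|\leq \gamma(\|x\|,k).$$ Then: 1. $\limsup_{n\to+\infty}\nu_n\leq 0$; and if, moreover, there exist $k\in\mathbb{N}$ and $x\in X^{\mathrm{in}}$ with $\varphi(T^k(x))>0$, then the set $\{k\in\mathbb{N} : \nu_k>\limsup_{n\to+\infty}\nu_n\}$ is nonempty. 2. There exists $h\in\mathcal{K}_\infty$ such that $(h,e^{-1})\in\Gamma(\nu)$; and if, moreover, there exist $k\in\mathbb{N}$ and $x\in X^{\mathrm{in}}$ with $\varphi(T^k(x))>0$, then $h$ is useful for $\nu$.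
   Context: $\mathbb{N}$ includes $0$; $\mathbb{R}_+=[0,+\infty)$; $\|\cdot\|$ is the Euclidean norm on $\mathbb{R}^d$; $T^k$ is the $k$-fold composition of $T$, with $T^0=\mathrm{Id}$. Comparison functions. A function $\alpha:[0,a)\to\mathbb{R}_+$ (for some $a>0$, possibly $a=+\infty$) belongs to $\mathcal{K}$ if it is strictly increasing and continuous on $[0,a)$ and $\alpha(0)=0$; if moreover $a=+\infty$ and $\lim_{x\to+\infty}\alpha(x)=+\infty$, then $\alpha\in\mathcal{K}_\infty$. A function $\sigma:\mathbb{R}_+\to\mathbb{R}_+$ belongs to $\mathcal{L}$ if it is continuous, decreasing, and $\lim_{x\to+\infty}\sigma(x)=0$. A function $\gamma:\mathbb{R}_+\times\mathbb{R}_+\to\mathbb{R}_+$ belongs to $\mathcal{KL}$ if for all $t\in\mathbb{R}_+$ the map $s\mapsto\gamma(s,t)$ belongs to $\mathcal{K}$, and for all $s\in\mathbb{R}_+$ the map $t\mapsto\gamma(s,t)$ belongs to $\mathcal{L}$. Upper-bounding pairs. $\Omega([0,1])$ is the set of functions $h:\mathbb{R}\to\mathbb{R}$ that are strictly increasing and continuous on $[0,1]$; such a function may be given only on a set containing $[0,1]$ (e.g. $\mathbb{R}_+$), its extension to $\mathbb{R}$ being arbitrary. For a real sequence $u=(u_k)_{k\in\mathbb{N}}$, $\Gamma(u):=\{(h,\beta)\in\Omega([0,1])\times(0,1) : u_k\leq h(\beta^k)\ \forall k\in\mathbb{N}\}$. For $u$ bounded above with $\{k : u_k>\limsup_{n\to+\infty}u_n\}\neq\emptyset$,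 a function $h\in\Omega([0,1])$ for which there is $\beta\in(0,1)$ with $(h,\beta)\in\Gamma(u)$ is called useful for $u$ if $\{k\in\mathbb{N} : u_k>h(0)\}\neq\emptyset$. *)

(* Defs.v *)
From mathcomp Require Import all_boot all_order all_algebra.
From mathcomp Require Import all_classical all_reals all_analysis.

Set Implicit Arguments.
Unset Strict Implicit.
Unset Printing Implicit Defensive.

Import Order.TTheory GRing.Theory Num.Theory.
Import numFieldNormedType.Exports.

Local Open Scope classical_set_scope.
Local Open Scope ring_scope.

(* Needed because the library norm on matrices is the maximum norm; the
   topology of 'rV[R]_d (entrywise convergence) is the Euclidean one. *)
Definition enorm (R : realType) (d : nat) (x : 'rV[R]_d) : R :=
  Num.sqrt (\sum_(i < d) x 0 i ^+ 2).

Definition ebounded (R : realType) (d : nat) (X : set 'rV[R]_d) : Prop :=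
  exists M : R, forall x, X x -> enorm x <= M.

(* A function with domain [0, a) or R_+ is encoded as a total function on R
   of which only the values on that domain matter; accordingly, continuity is
   always continuity of the restriction. *)
Definition classK (R : realType) (a : \bar R) (alpha : R -> R) : Prop :=
  let D := [set x : R | 0 <= x /\ (x%:E < a)%E] in
  [/\ (0 < a)%E,
      forall x, D x -> 0 <= alpha x,
      forall x y, D x -> D y -> x < y -> alpha x < alpha y,
      {within D, continuous alpha} &
      alpha 0 = 0].

Definition classKinfty (R : realType) (alpha : R -> R) : Prop :=
  classK +oo%E alpha /\ alpha x @[x --> +oo] --> +oo.

(* "Decreasing" is meant in the weak sense: a KL function vanishes
   identically on {0} x R_+, so a strict reading would leave KL empty. *)
Definition classL (R : realType) (sigma : R -> R) : Prop :=
  [/\ forall x : R, 0 <= x -> 0 <= sigma x,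
      {within [set x : R | 0 <= x], continuous sigma},
      forall x y : R, 0 <= x -> x <= y -> sigma y <= sigma x &
      sigma x @[x --> +oo] --> (0 : R)].

Definition classKL (R : realType) (gamma : R -> R -> R) : Prop :=
  (forall t : R, 0 <= t -> classK +oo%E (fun s => gamma s t)) /\
  (forall s : R, 0 <= s -> classL (fun t => gamma s t)).

Definition Omega01 (R : realType) : set (R -> R) :=
  [set h : R -> R |
    (forall x y : R, 0 <= x -> x < y -> y <= 1 -> h x < h y) /\
    {within `[0, 1], continuous h}].

Definition Gamma (R : realType) (u : nat -> R) : set ((R -> R) * R) :=
  [set p | [/\ Omega01 p.1, 0 < p.2 < 1 & forall k, u k <= p.1 (p.2 ^+ k)]].

Definition above_limsup (R : realType) (u : nat -> R) : set nat :=
  [set k | (limn_esup (fun n => (u n)%:E) < (u k)%:E)%E].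

(* The standing conditions on u under which usefulness is considered are part
   of the definition. *)
Definition useful (R : realType) (u : nat -> R) (h : R -> R) : Prop :=
  [/\ has_ubound (range u),
      above_limsup u !=set0,
      Omega01 h,
      exists beta, Gamma u (h, beta) &
      [set k | h 0 < u k] !=set0].

Definition nu_bar (R : realType) (d : nat) (X : set 'rV[R]_d)
    (T : 'rV[R]_d -> 'rV[R]_d) (phi : 'rV[R]_d -> R) (k : nat) : \bar R :=
  ereal_sup [set (phi (iter k T x))%:E | x in X].

(* [fine] is faithful only where [nu_bar] is finite. *)
Definition nu (R : realType) (d : nat) (X : set 'rV[R]_d)
    (T : 'rV[R]_d -> 'rV[R]_d) (phi : 'rV[R]_d -> R) (k : nat) : R :=
  fine (nu_bar X T phi k).

(* Main.v *)
Require Import Defs.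
From mathcomp Require Import all_boot all_order all_algebra.
From mathcomp Require Import all_classical all_reals all_analysis.

Set Implicit Arguments.
Unset Strict Implicit.
Unset Printing Implicit Defensive.

Import Order.TTheory GRing.Theory Num.Theory.
Import numFieldNormedType.Exports.
Local Open Scope classical_set_scope.
Local Open Scope ring_scope.

(** Only two features of the dynamics matter.  A bounded [Xin] lies in a ball
    of some radius [S], and [gamma] is increasing in its first argument, so
    every orbit is dominated by the single null sequence [gamma S k]: the
    iterates converge to [0] uniformly over [Xin].  Continuity of [phi] at [0]
    and [phi 0 = 0] then turn this into
      for every [e > 0], [nu k <= e] for all large [k]     (uniform decay),
    which is [nu_eventually_le] and gives [limsup nu <= 0].  If [phi] is positive
    somewhere on an orbit, the corresponding [nu k] is positive, hence
    strictly above the limsup and above the value at [0] of any function of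
    class K.

    The function [h] depends only on the sequence.  With [v k] the positive
    part of [nu k] and [b] in (0, 1), consider the ramps
      [v k * min 1 (x / b^k)],
    which climb from [0] to the value [v k] exactly at [x = b^k] and are
    constant afterwards.  Their supremum over [k] dominates [v k] at [b^k], is
    nondecreasing and vanishes at [0].  It is continuous because [v] tends to
    [0]: up to [e] only finitely many ramps matter, and those share a Lipschitz
    constant.  Adding the identity makes it strictly increasing and unbounded,
    hence of class K-infinity. *)

(** * Suprema of ramps *)

Definition ramp (R : realType) (b : R) (v : nat -> R) (k : nat) (x : R) : R :=
  v k * Num.min 1 (x / b ^+ k).

Definition ramp_sup (R : realType) (b : R) (v : nat -> R) (x : R) : R :=
  sup (range (fun k => ramp b v k x)).

Lemma ramp_le_height (R : realType) (b : R) (v : nat -> R) (k : nat) (x : R) :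
  0 <= v k -> ramp b v k x <= v k.
Proof. by move=> v0; rewrite /ramp ler_piMr // ge_min lexx. Qed.

Lemma ramp_at_pow (R : realType) (b : R) (v : nat -> R) (k : nat) :
  0 < b -> ramp b v k (b ^+ k) = v k.
Proof.
by move=> b0; rewrite /ramp divff ?minxx ?mulr1 // expf_neq0 // gt_eqF.
Qed.

Lemma ramp_at0 (R : realType) (b : R) (v : nat -> R) (k : nat) :
  ramp b v k 0 = 0.
Proof. by rewrite /ramp mul0r min_r ?mulr0. Qed.

Lemma ramp_le (R : realType) (b : R) (v : nat -> R) (k : nat) (x y : R) :
  0 < b -> 0 <= v k -> x <= y -> ramp b v k x <= ramp b v k y.
Proof.
move=> b0 v0 xy; rewrite /ramp ler_wpM2l //.
rewrite le_min ge_min lexx /= ge_min ler_wpM2r ?orbT //.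
by rewrite invr_ge0 exprn_ge0 // ltW.
Qed.

Lemma ramp_lipschitz (R : realType) (b : R) (v : nat -> R) (k : nat) (x y : R) :
  0 < b -> 0 <= v k ->
  ramp b v k y <= ramp b v k x + v k / b ^+ k * `|x - y|.
Proof.
move=> b0 v0; have bk0 : 0 <= (b ^+ k)^-1 by rewrite invr_ge0 exprn_ge0 // ltW.
rewrite /ramp -mulrA -mulrDr ler_wpM2l // addr_minl le_min.
have d0 : 0 <= (b ^+ k)^-1 * `|x - y| by rewrite mulr_ge0.
rewrite ge_min lerDl d0 /= ge_min; apply/orP; right.
rewrite -lerBlDl -mulrBl mulrC ler_wpM2l // distrC; exact: ler_norm.
Qed.

Section RampSup.
Variables (R : realType) (b : R) (v : nat -> R).
Hypotheses (b_gt0 : 0 < b) (v_ge0 : forall k, 0 <= v k).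
Hypothesis v_null : v @ \oo --> (0 : R).

Lemma has_ubound_ramps (x : R) : has_ubound (range (fun k => ramp b v k x)).
Proof.
have /cvg_seq_bounded/bounded_fun_has_ubound[M Mv] : cvgn v.
  by apply/cvg_ex; exists 0.
exists M => _ [k _ <-]; apply: le_trans (ramp_le_height b x (v_ge0 k)) _.
by apply: Mv; exists k.
Qed.

Lemma ramp_le_sup (k : nat) (x : R) : ramp b v k x <= ramp_sup b v x.
Proof. by apply: ub_le_sup; [exact: has_ubound_ramps | exists k]. Qed.

Lemma ramp_sup_le (x M : R) :
  (forall k, ramp b v k x <= M) -> ramp_sup b v x <= M.
Proof.
by move=> xM; apply: ge_sup => [|_ [k _ <-]//]; exists (ramp b v 0 x), 0%N.
Qed.

Lemma le_ramp_sup_pow (k : nat) : v k <= ramp_sup b v (b ^+ k).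
Proof. by rewrite -[leLHS](ramp_at_pow v k b_gt0) ramp_le_sup. Qed.

Lemma ramp_sup0 : ramp_sup b v 0 = 0.
Proof.
apply/le_anti/andP; split; first by apply: ramp_sup_le => k; rewrite ramp_at0.
by rewrite -[leLHS](ramp_at0 b v 0%N) ramp_le_sup.
Qed.

Lemma ramp_sup_homo : {homo ramp_sup b v : x y / x <= y}.
Proof.
move=> x y xy; apply: ramp_sup_le => k; apply: le_trans (ramp_le_sup k y).
exact: ramp_le.
Qed.

(** Beyond some rank [K] every ramp stays below [e]; the finitely many others
    have slopes bounded by the sum [L] of theirs. *)
Lemma ramp_sup_modulus (e : R) : 0 < e ->
  exists2 L, 0 <= L & forall x y, 0 <= x ->
    ramp_sup b v y <= ramp_sup b v x + e + L * `|x - y|.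
Proof.
move=> e0; have /cvgr_le/(_ e e0)[K _ Ke] := v_null.
have s0 k : 0 <= v k / b ^+ k by rewrite divr_ge0 // exprn_ge0 // ltW.
have L0 : 0 <= \sum_(k < K) v k / b ^+ k by rewrite sumr_ge0.
exists (\sum_(k < K) v k / b ^+ k) => // x y x0; apply: ramp_sup_le => k.
have [kK|Kk] := ltnP k K.
  apply: le_trans (ramp_lipschitz x y b_gt0 (v_ge0 k)) _.
  apply: lerD; first by apply: le_trans (ramp_le_sup k x) _; rewrite lerDl ltW.
  apply: ler_wpM2r => //; rewrite (bigD1 (Ordinal kK)) //= lerDl.
  by rewrite sumr_ge0.
apply: le_trans (ramp_le_height b y (v_ge0 k)) _.
apply: le_trans (Ke k Kk) _.
rewrite -addrA [leRHS]addrCA lerDl addr_ge0 ?mulr_ge0 //.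
by rewrite -ramp_sup0 ramp_sup_homo.
Qed.

Lemma ramp_sup_continuous :
  {within [set x : R | 0 <= x], continuous (ramp_sup b v)}.
Proof.
apply/subspace_continuousP => x /= x0; apply/cvgrPdist_le => e e0.
have e2 : 0 < e / 2 by rewrite divr_gt0.
have [L L0 modL] := ramp_sup_modulus e2.
(* [L] may be 0, hence the radius [e / 2 / (L + 1)]. *)
have L1 : 0 < L + 1 by rewrite ltr_wpDl.
apply/nbhs_ballP; exists (e / 2 / (L + 1)) => /=; first exact: divr_gt0.
move=> y /= xy y0.
have Lxy : L * `|x - y| <= e / 2.
  apply: le_trans (_ : (L + 1) * `|x - y| <= _).
    by rewrite ler_wpM2r ?lerDl.
  by rewrite mulrC -ler_pdivlMr // ltW.
rewrite ler_distl; apply/andP; split.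
  rewrite lerBlDr; apply: le_trans (modL x y x0) _.
  by rewrite -addrA lerD2l [leRHS](splitr e) lerD2l.
apply: le_trans (modL y x y0) _.
by rewrite -addrA lerD2l [leRHS](splitr e) lerD2l distrC.
Qed.

End RampSup.

(** A sequence that is eventually below every positive number has an
    upper-bounding function of class K-infinity along any geometric sequence. *)
Lemma classKinfty_geometric_bound (R : realType) (b : R) (u : nat -> R) :
  0 < b -> (forall e : R, 0 < e -> \forall k \near \oo, u k <= e) ->
  exists h : R -> R, classKinfty h /\ forall k, u k <= h (b ^+ k).
Proof.
move=> b0 u_le; pose v k := Num.max 0 (u k).
have v0 k : 0 <= v k by rewrite le_max lexx.
have v_null : v @ \oo --> (0 : R).
  apply/cvgrPdist_le => e e0; apply: filterS (u_le e e0) => k uke.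
  by rewrite sub0r normrN ger0_norm // ge_max uke ltW.
pose H := ramp_sup b v.
have H_homo := ramp_sup_homo b0 v0 v_null.
have H0 : H 0 = 0 := ramp_sup0 b v0 v_null.
have H_ge0 x : 0 <= x -> 0 <= H x by move=> x0; rewrite -H0 H_homo.
have domE : [set x : R | 0 <= x /\ (x%:E < +oo)%E] = [set x | 0 <= x].
  by apply/seteqP; split=> x /= => [[]//|x0]; rewrite ltry.
exists (fun x => x + H x); split; last first.
  move=> k; apply: le_trans (_ : v k <= _); first by rewrite le_max lexx orbT.
  apply: le_trans (le_ramp_sup_pow b0 v0 v_null k) _.
  by rewrite lerDr exprn_ge0 // ltW.
split; last first.
  apply/cvgryPge => A; near=> x.
  apply: le_trans (_ : x <= _); first by near: x; exact: nbhs_pinfty_ge (num_real _).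
  by rewrite lerDl H_ge0 //; near: x; exact: nbhs_pinfty_ge (num_real _).
split=> //.
- by move=> x [x0 _]; rewrite addr_ge0 // H_ge0.
- by move=> x y _ _ xy; rewrite ltr_leD // H_homo // ltW.
- rewrite domE; apply/subspace_continuousP => x x0; apply: cvgD.
    exact: cvg_within.
  by have /subspace_continuousP := ramp_sup_continuous b0 v0 v_null; apply.
- by rewrite add0r.
Unshelve. all: by end_near. Qed.

Lemma classK_Omega01 (R : realType) (h : R -> R) :
  classK +oo%E h -> Omega01 h.
Proof.
move=> [_ _ h_incr h_cont _]; split.
  move=> x y x0 xy _; apply: h_incr => //; split; rewrite ?ltry //.
  exact: le_trans x0 (ltW xy).
apply: continuous_subspaceW h_cont => x /=; rewrite in_itv /= => /andP[x0 _].
by rewrite ltry.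
Qed.

(** * Decay of the suprema along the orbits *)

Lemma enorm_ge0 (R : realType) (d : nat) (x : 'rV[R]_d) : 0 <= enorm x.
Proof. exact: sqrtr_ge0. Qed.

Lemma coord_le_enorm (R : realType) (d : nat) (x : 'rV[R]_d) (i : 'I_d) :
  `|x 0 i| <= enorm x.
Proof.
rewrite -sqrtr_sqr ler_wsqrtr // (bigD1 i) //= lerDl sumr_ge0 // => j _.
exact: sqr_ge0.
Qed.

(** Neighborhoods of [0] are those of the maximum norm, which the Euclidean norm
    dominates. *)
Lemma nbhs0_enorm (R : realType) (d : nat) (A : set 'rV[R]_d) :
  nbhs (0 : 'rV[R]_d) A -> exists2 r : R, 0 < r & forall x, enorm x < r -> A x.
Proof.
move=> /nbhs_ballP[r /= r0 rA]; exists r => // x xr; apply: rA; split=> // i j.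
rewrite ord1 mxE /ball /= sub0r normrN.
exact: le_lt_trans (coord_le_enorm _ _) xr.
Qed.

(** The radius of a ball around the initial set, put in the first slot of
    [gamma], gives a rate of convergence valid for all orbits at once. *)
Lemma orbits_uniformly_null (R : realType) (d : nat) (X : set 'rV[R]_d)
    (T : 'rV[R]_d -> 'rV[R]_d) (gamma : R -> R -> R) :
  ebounded X -> classKL gamma ->
  (forall x, X x -> forall k : nat,
     enorm (iter k T x) <= gamma (enorm x) k%:R) ->
  forall r : R, 0 < r ->
    \forall k \near \oo, forall x, X x -> enorm (iter k T x) < r.
Proof.
move=> [M XM] [gK gL] Xg r r0.
pose S := Num.max 0 M; have S0 : 0 <= S by rewrite le_max lexx.
have [_ _ _ gS0] := gL S S0.
have gS0n : gamma S k%:R @[k --> \oo] --> (0 : R).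
  exact: cvg_comp cvgr_idn gS0.
apply: filterS (cvgr_lt _ gS0n r r0) => k gSk x Xx.
apply: le_lt_trans (Xg x Xx k) _; apply: le_lt_trans gSk.
have [_ _ g_incr _ _] := gK k%:R (ler0n _ _).
have : enorm x <= S by rewrite le_max XM ?orbT.
rewrite le_eqVlt => /predU1P[->//|xS].
by apply/ltW/g_incr => //; split; rewrite ?ltry ?enorm_ge0.
Qed.

Lemma phi_le_nu (R : realType) (d : nat) (X : set 'rV[R]_d)
    (T : 'rV[R]_d -> 'rV[R]_d) (phi : 'rV[R]_d -> R) (k : nat) (x : 'rV[R]_d) :
  nu_bar X T phi k \is a fin_num -> X x -> phi (iter k T x) <= nu X T phi k.
Proof.
move=> fin Xx; rewrite -lee_fin /nu fineK //.
by apply: ereal_sup_ubound; exists x.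
Qed.

Lemma nu_le (R : realType) (d : nat) (X : set 'rV[R]_d)
    (T : 'rV[R]_d -> 'rV[R]_d) (phi : 'rV[R]_d -> R) (k : nat) (M : R) :
  nu_bar X T phi k \is a fin_num ->
  (forall x, X x -> phi (iter k T x) <= M) -> nu X T phi k <= M.
Proof.
move=> fin XM; rewrite -lee_fin /nu fineK //.
by apply: ge_ereal_sup => _ [x Xx <-]; rewrite lee_fin XM.
Qed.

Lemma nu_eventually_le (R : realType) (d : nat) (X : set 'rV[R]_d)
    (T : 'rV[R]_d -> 'rV[R]_d) (phi : 'rV[R]_d -> R) :
  phi 0 = 0 -> {for 0, continuous phi} ->
  (forall k, nu_bar X T phi k \is a fin_num) ->
  (forall r : R, 0 < r ->
     \forall k \near \oo, forall x, X x -> enorm (iter k T x) < r) ->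
  forall e : R, 0 < e -> \forall k \near \oo, nu X T phi k <= e.
Proof.
move=> phi0 phi_cont fin orbits e e0.
have /nbhs0_enorm[r r0 phi_le] : nbhs (0 : 'rV[R]_d) [set y | phi y <= e].
  by apply: (cvgr_le _ phi_cont); rewrite phi0.
apply: filterS (orbits r r0) => k Tk; apply: nu_le => // x Xx.
exact/phi_le/Tk.
Qed.

Lemma limn_esup_le0 (R : realType) (u : nat -> R) :
  (forall e : R, 0 < e -> \forall k \near \oo, u k <= e) ->
  (limn_esup (fun n => (u n)%:E) <= 0)%E.
Proof.
move=> u_le; apply/lee_addgt0Pr => e e0; rewrite add0e.
pose V := [set k | u k <= e].
have sup_le : (ereal_sup ((fun n => (u n)%:E) @` V) <= e%:E)%E.
  by apply: ge_ereal_sup => _ [k /= uk <-]; rewrite lee_fin.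
by apply: le_trans sup_le; apply: ereal_inf_lbound; exists V => //; exact: u_le.
Qed.

Theorem theorem5 (R : realType) (d : nat) (Xin : set 'rV[R]_d)
    (T : 'rV[R]_d -> 'rV[R]_d) (phi : 'rV[R]_d -> R)
    (Xin_nonempty : Xin !=set0)
    (T_nonzero : exists x, T x <> 0)
    (phi0 : phi 0 = 0)
    (nu_finite : forall k : nat, nu_bar Xin T phi k \is a fin_num)
    (phi_continuous : continuous phi)
    (Xin_bounded : ebounded Xin)
    (Xin_not_zero : Xin <> [set 0])
    (stable : exists gamma : R -> R -> R, classKL gamma /\
       forall x, Xin x -> forall k : nat,
         enorm (iter k T x) <= gamma (enorm x) k%:R) :
  ((limn_esup (fun n => (nu Xin T phi n)%:E) <= 0)%E /\
   ((exists (k : nat) (x : 'rV[R]_d), Xin x /\ 0 < phi (iter k T x)) ->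
    above_limsup (nu Xin T phi) !=set0)) /\
  (exists h : R -> R,
     [/\ classKinfty h,
         Gamma (nu Xin T phi) (h, expR (- 1)) &
         (exists (k : nat) (x : 'rV[R]_d), Xin x /\ 0 < phi (iter k T x)) ->
         useful (nu Xin T phi) h]).
Proof.
have [gamma [gKL Xg]] := stable.
have nu_small := nu_eventually_le phi0 (phi_continuous 0) nu_finite
  (orbits_uniformly_null Xin_bounded gKL Xg).
have limsup_le0 := limn_esup_le0 nu_small.
have nu_pos : (exists (k : nat) (x : 'rV[R]_d), Xin x /\ 0 < phi (iter k T x)) ->
    exists k, 0 < nu Xin T phi k.
  move=> [k [x [Xx phi_gt0]]]; exists k.
  exact: lt_le_trans phi_gt0 (phi_le_nu (nu_finite k) Xx).
have above : (exists (k : nat) (x : 'rV[R]_d), Xin x /\ 0 < phi (iter k T x)) ->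
    above_limsup (nu Xin T phi) !=set0.
  move=> /nu_pos[k nuk]; exists k; apply: le_lt_trans limsup_le0 _.
  by rewrite lte_fin.
split=> //.
have b01 : 0 < expR (- 1 : R) < 1 by rewrite expR_gt0 expR_lt1 oppr_lt0 ltr01.
have /andP[b0 b1] := b01.
have [h [h_Kinfty nu_le_h]] := classKinfty_geometric_bound b0 nu_small.
have [h_K _] := h_Kinfty.
have h_Omega := classK_Omega01 h_K.
have h_Gamma : Gamma (nu Xin T phi) (h, expR (- 1)) by split.
exists h; split=> // positive; split=> //.
- exists (h 1) => _ [k _ <-]; apply: le_trans (nu_le_h k) _.
  have := exprn_ile1 k (ltW b0) (ltW b1).
  rewrite le_eqVlt => /predU1P[->//|bk1].
  by apply/ltW/h_Omega.1 => //; rewrite exprn_ge0 // ltW.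
- exact: above.
- by exists (expR (- 1)).
- have [k nuk] := nu_pos positive; have [_ _ _ _ h0] := h_K.
  by exists k; rewrite /= h0.
Qed.
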